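(* Let $K$ be a field of characteristic different from $2$ and $3$ and let $(M,[\,,\,],A)$ be an Akivis superalgebra over $K$. Then the canonical map $\iota:M\to\tilde U(M)$ (defined in the context) is injective.
   Context: A superalgebra is a (not necessarily associative) $\mathbb{Z}_2$-graded algebra over $K$. Akivis superalgebra: a supervector space $M=M_0\oplus M_1$ with (i) a bilinear map $[\,,\,]$ making $M$ a superalgebra ($[M_\alpha,M_\beta]\subseteq M_{\alpha+\beta}$) that is superanticommutative ($[x,y]=-(-1)^{\alpha\beta}[y,x]$ for $x\in M_\alpha,y\in M_\beta$), and (ii) a trilinear map $A:M\times M\times M\to M$ with $A(M_\alpha,M_\beta,M_\gamma)\subseteq M_{\alpha+\beta+\gamma}$, such that for all $x\in M_\alpha,y\in M_\beta,z\in M_\gamma$, $$[[x,y],z]+(-1)^{\alpha(\beta+\gamma)}[[y,z],x]+(-1)^{\gamma(\alpha+\beta)}[[z,x],y]=A(x,y,z)+(-1)^{\alpha(\beta+\gamma)}A(y,z,x)+(-1)^{\gamma(\alpha+\beta)}A(z,x,y)-(-1)^{\alpha\beta}A(y,x,z)-(-1)^{\alpha(\beta+\gamma)+\beta\gamma}A(z,y,x)-(-1)^{\beta\gamma}A(x,z,y).$$ $\tilde T(M)=\bigoplus_{n\ge 0}\tilde T^n(M)$ is the nonassociative tensor algebra: $\tilde T^0(M)=K$, $\tilde T^1(M)=M$, $\tilde T^n(M)=\bigoplus_{i=1}^{n-1}\tilde T^i(M)\otimes\tilde T^{n-i}(M)$ for $n\ge2$, with multiplication $xy=x\otimes y$ (elements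 of $K$ acting by scalar multiplication) and the $\mathbb{Z}_2$-grading induced from $M$. Let $I$ be the two-sided ideal of $\tilde T(M)$ generated by the elements $x\otimes y-(-1)^{\alpha\beta}y\otimes x-[x,y]$ and $(x\otimes y)\otimes z-x\otimes(y\otimes z)-A(x,y,z)$ for $x\in M_\alpha,y\in M_\beta,z\in M_\gamma$, $\alpha,\beta,\gamma\in\mathbb{Z}_2$. Put $\tilde U(M)=\tilde T(M)/I$, and let $\iota:M\to\tilde U(M)$ be the composition of the inclusion $M=\tilde T^1(M)\subseteq\tilde T(M)$ with the quotient map. *)

(* Defs.v *)
From HB Require Import structures.
From mathcomp Require Import all_boot all_algebra.
From mathcomp Require Import boolp zify freeg.
From Stdlib Require Wf_nat.

Set Implicit Arguments.
Unset Strict Implicit.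
Unset Printing Implicit Defensive.

Import GRing.Theory.
Local Open Scope ring_scope.
Local Open Scope quotient_scope.

Section LinearQuotient.
Variables (K : fieldType) (V : lmodType K) (S : submodClosed V).

Definition submod_pred : {pred V} := fun v => v \in S.
HB.instance Definition _ :=
  GRing.isZmodClosed.Build V submod_pred (GRing.submod_closedB (submodClosedP S)).

Definition lquot := Quotient.quot submod_pred.
HB.instance Definition _ := GRing.Zmodule.on lquot.
HB.instance Definition _ := EqQuotient.on lquot.

Definition lquot_pi (x : V) : lquot := \pi_lquot x.

Definition lquot_scale (a : K) := lift_op1 lquot ( *:%R a).

Lemma lquot_piP x y : (lquot_pi x == lquot_pi y) = (x - y \in S).
Proof. exact: esym (Quotient.idealrBE submod_pred x y). Qed.

Lemma lquot_piD x y : lquot_pi (x + y) = lquot_pi x + lquot_pi y.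
Proof. exact: (raddfD (\pi_(Quotient.quot submod_pred))). Qed.

Lemma lquot_scaleE a x : lquot_scale a (lquot_pi x) = lquot_pi (a *: x).
Proof.
rewrite /lquot_scale; unlock; apply/eqP; rewrite lquot_piP -scalerBr rpredZ //.
by rewrite -lquot_piP /lquot_pi reprK.
Qed.

Lemma lquot_ind (P : lquot -> Prop) : (forall x, P (lquot_pi x)) -> forall u, P u.
Proof. by move=> Ppi u; rewrite -[u]reprK; apply: Ppi. Qed.

Fact lquot_scaleA a b u : lquot_scale a (lquot_scale b u) = lquot_scale (a * b) u.
Proof. by elim/lquot_ind: u => x; rewrite !lquot_scaleE scalerA. Qed.
Fact lquot_scale1 : left_id 1 lquot_scale.
Proof. by elim/lquot_ind=> x; rewrite lquot_scaleE scale1r. Qed.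
Fact lquot_scaleDr : right_distributive lquot_scale +%R.
Proof.
move=> a; elim/lquot_ind=> x; elim/lquot_ind=> y.
by rewrite -lquot_piD !lquot_scaleE scalerDr lquot_piD.
Qed.
Fact lquot_scaleDl u : {morph lquot_scale^~ u : a b / a + b}.
Proof.
by move=> a b; elim/lquot_ind: u => x; rewrite !lquot_scaleE scalerDl lquot_piD.
Qed.
HB.instance Definition _ := GRing.Zmodule_isLmodule.Build K lquot
  lquot_scaleA lquot_scale1 lquot_scaleDr lquot_scaleDl.

Lemma lquot_piZ a x : lquot_pi (a *: x) = a *: lquot_pi x.
Proof. by rewrite -lquot_scaleE. Qed.

End LinearQuotient.

(* Linear span of a set X of vectors, as the smallest subspace containing X. *)
Section Span.
Variables (K : fieldType) (V : lmodType K) (X : V -> Prop).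

Definition lspan : {pred V} := fun v =>
  `[< forall S : submodClosed V, (forall x, X x -> x \in S) -> v \in S >].

Fact lspan_submod : submod_closed lspan.
Proof.
split=> [|a u v /asboolP uX /asboolP vX]; apply/asboolP=> S XS.
  by case: (submodClosedP S).
by case: (submodClosedP S) => _; apply; [apply: uX | apply: vX].
Qed.
HB.instance Definition _ := GRing.isSubmodClosed.Build K V lspan
  (GRing.submod_closed_semi lspan_submod).

Lemma mem_lspan x : X x -> x \in lspan.
Proof. by move=> Xx; apply/asboolP=> S; apply. Qed.

End Span.

(* External direct sum of a family of vector spaces, as the space of finitely
   supported dependent functions. *)
Section DirectSum.
Variables (K : fieldType) (I : eqType) (V : I -> lmodType K).

Definition dprod := forall i, V i.
HB.instance Definition _ := gen_eqMixin dprod.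
HB.instance Definition _ := gen_choiceMixin dprod.

Let pzero : dprod := fun i => 0.
Let popp (f : dprod) : dprod := fun i => - f i.
Let padd (f g : dprod) : dprod := fun i => f i + g i.
Let pscale (a : K) (f : dprod) : dprod := fun i => a *: f i.

Fact dprod_addA : associative padd.
Proof. by move=> f g h; apply: functional_extensionality_dep => i; apply: addrA. Qed.
Fact dprod_addC : commutative padd.
Proof. by move=> f g; apply: functional_extensionality_dep => i; apply: addrC. Qed.
Fact dprod_add0 : left_id pzero padd.
Proof. by move=> f; apply: functional_extensionality_dep => i; apply: add0r. Qed.
Fact dprod_addN : left_inverse pzero popp padd.
Proof. by move=> f; apply: functional_extensionality_dep => i; apply: addNr. Qed.
HB.instance Definition _ :=
  GRing.isZmodule.Build dprod dprod_addA dprod_addC dprod_add0 dprod_addN.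

Fact dprod_scaleA a b f : pscale a (pscale b f) = pscale (a * b) f.
Proof. by apply: functional_extensionality_dep => i; apply: scalerA. Qed.
Fact dprod_scale1 : left_id 1 pscale.
Proof. by move=> f; apply: functional_extensionality_dep => i; apply: scale1r. Qed.
Fact dprod_scaleDr : right_distributive pscale +%R.
Proof. by move=> a f g; apply: functional_extensionality_dep => i; apply: scalerDr. Qed.
Fact dprod_scaleDl f : {morph pscale^~ f : a b / a + b}.
Proof. by move=> a b; apply: functional_extensionality_dep => i; apply: scalerDl. Qed.
HB.instance Definition _ := GRing.Zmodule_isLmodule.Build K dprod
  dprod_scaleA dprod_scale1 dprod_scaleDr dprod_scaleDl.

Definition finsupp : {pred dprod} := fun f =>
  `[< exists s : seq I, forall i, i \notin s -> f i = 0 >].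

Fact finsupp_submod : submod_closed finsupp.
Proof.
split=> [|a f g /asboolP[s fs] /asboolP[t gt]]; apply/asboolP.
  by exists [::].
exists (s ++ t) => i; rewrite mem_cat negb_or => /andP[/fs fi0 /gt gi0].
by transitivity (a *: f i + g i); rewrite // fi0 gi0 scaler0 addr0.
Qed.
HB.instance Definition _ := GRing.isSubmodClosed.Build K dprod finsupp
  (GRing.submod_closed_semi finsupp_submod).

Record dsum := DSum { dsum_fun : dprod; _ : dsum_fun \in finsupp }.
HB.instance Definition _ := [isSub for dsum_fun].
HB.instance Definition _ := [Choice of dsum by <:].
HB.instance Definition _ := [SubChoice_isSubLmodule of dsum by <:].

Definition dsum_app (x : dsum) : forall i, V i := dsum_fun x.
Coercion dsum_app : dsum >-> Funclass.

Lemma dsumP (x y : dsum) : (forall i, x i = y i) <-> x = y.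
Proof.
split=> [xy|-> //]; apply: val_inj; exact: functional_extensionality_dep.
Qed.

Lemma dsum_finsupp (x : dsum) : exists s : seq I, forall i, i \notin s -> x i = 0.
Proof. by case: x => f /= /asboolP. Qed.

Lemma dsum0E i : (0 : dsum) i = 0. Proof. by []. Qed.
Lemma dsumDE (x y : dsum) i : (x + y) i = x i + y i. Proof. by []. Qed.
Lemma dsumZE a (x : dsum) i : (a *: x) i = a *: x i. Proof. by []. Qed.

End DirectSum.

Section DirectSumFin.
Variables (K : fieldType) (I : finType) (V : I -> lmodType K).

Fact finsupp_fin (f : forall i, V i) : (f : dprod V) \in @finsupp K I V.
Proof. by apply/asboolP; exists (enum I) => i; rewrite mem_enum. Qed.

Definition dsum_fin (f : forall i, V i) : dsum V := DSum (finsupp_fin f).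

End DirectSumFin.

(* V (x) W as the free vector space on V * W modulo the bilinearity relations. *)
Section TensorProduct.
Variables (K : fieldType) (V W : lmodType K).

Definition pure (v : V) (w : W) : {freeg (V * W)%type / K} := << (v, w) >>.

Inductive tensor_rel : {freeg (V * W)%type / K} -> Prop :=
| tensor_rel_l a v v' w :
    tensor_rel (pure (a *: v + v') w - (a *: pure v w + pure v' w))
| tensor_rel_r a v w w' :
    tensor_rel (pure v (a *: w + w') - (a *: pure v w + pure v w')).

Definition tensor : lmodType K := lquot (lspan tensor_rel).
Definition tens (v : V) (w : W) : tensor := lquot_pi _ (pure v w).

Lemma tens_bilinear : bilinear_for *:%R *:%R tens.
Proof.
have rel_eq x y (r : tensor_rel (x - y)) :
    lquot_pi (lspan tensor_rel) x = lquot_pi (lspan tensor_rel) y.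
  by apply/eqP; rewrite lquot_piP; apply: mem_lspan.
split=> [w a v v'|v a w w'] /=.
  by rewrite /tens (rel_eq _ _ (tensor_rel_l a v v' w)) lquot_piD lquot_piZ.
by rewrite /tens (rel_eq _ _ (tensor_rel_r a v w w')) lquot_piD lquot_piZ.
Qed.

Lemma tens0l w : tens 0 w = 0.
Proof.
have : tens (-1 *: 0 + 0) w = -1 *: tens 0 w + tens 0 w := tens_bilinear.1 w _ _ _.
by rewrite scaler0 addr0 scaleN1r addNr.
Qed.

Lemma tens0r v : tens v 0 = 0.
Proof.
have : tens v (-1 *: 0 + 0) = -1 *: tens v 0 + tens v 0 := tens_bilinear.2 v _ _ _.
by rewrite scaler0 addr0 scaleN1r addNr.
Qed.

End TensorProduct.

Section NonassocTensorAlgebra.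
Variables (K : fieldType) (M : lmodType K).

Fact tpow_ltl n (i : 'I_n.+1) : (i.+1 < n.+2)%coq_nat.
Proof. by apply/ltP; rewrite ltnS. Qed.
Fact tpow_ltr n (i : 'I_n.+1) : (n.+1 - i < n.+2)%coq_nat.
Proof. by apply/ltP; rewrite ltnS leq_subr. Qed.

(* tpow n is the n-th homogeneous component, given by the course-of-values
   recursion spelled out in tpow_rec and tpowE; the summand of index i in
   degree n.+2 is the one with left factor of degree i.+1. *)
Definition tpow_body n :
    (forall m, (m < n)%coq_nat -> lmodType K) -> lmodType K :=
  match n with
  | 0 => fun _ => (K^o : lmodType K)
  | 1 => fun _ => M
  | n'.+2 => fun T => (dsum (fun i : 'I_n'.+1 =>
      tensor (T _ (tpow_ltl i)) (T _ (tpow_ltr i))) : lmodType K)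
  end.

Definition tpow : nat -> lmodType K := Fix Wf_nat.lt_wf _ tpow_body.

Definition tpow_rec (n : nat) : lmodType K :=
  match n with
  | 0 => (K^o : lmodType K)
  | 1 => M
  | n'.+2 => (dsum (fun i : 'I_n'.+1 =>
      tensor (tpow i.+1) (tpow (n'.+1 - i))) : lmodType K)
  end.

Lemma tpowE n : tpow n = tpow_rec n.
Proof.
rewrite /tpow Fix_eq => [|m T T' TT']; first by case: n => [|[|n]].
congr tpow_body; apply: functional_extensionality_dep => k.
exact: functional_extensionality_dep.
Qed.

Definition unroll n (x : tpow n) : tpow_rec n :=
  eq_rect (tpow n) (fun U : lmodType K => GRing.Lmodule.sort U) x _ (tpowE n).
Definition roll n (x : tpow_rec n) : tpow n :=
  eq_rect (tpow_rec n) (fun U : lmodType K => GRing.Lmodule.sort U) x _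
    (esym (tpowE n)).

Lemma rollK n : cancel (@roll n) (@unroll n).
Proof.
rewrite /roll /unroll; move: (tpowE n); move: (tpow n) (tpow_rec n) => U W e.
by case: W / e.
Qed.

Lemma unrollK n : cancel (@unroll n) (@roll n).
Proof.
rewrite /roll /unroll; move: (tpowE n); move: (tpow n) (tpow_rec n) => U W e.
by case: W / e.
Qed.

Lemma unroll_linear n : linear (@unroll n).
Proof.
rewrite /unroll; move: (tpowE n); move: (tpow n) (tpow_rec n) => U W e.
by case: W / e.
Qed.

Lemma roll_linear n : linear (@roll n).
Proof.
rewrite /roll; move: (tpowE n); move: (tpow n) (tpow_rec n) => U W e.
by case: W / e.
Qed.

Lemma roll0 n : @roll n 0 = 0.
Proof.
have : @roll n (-1 *: 0 + 0) = -1 *: roll 0 + roll 0 := roll_linear _ _ _.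
by rewrite scaler0 addr0 scaleN1r addNr.
Qed.

Definition tensalg := dsum tpow.

(* The degree n component of x y is the sum over i + j = n of x_i y_j: the
   terms with i = 0 or j = 0 are scalar multiples, while the others are the
   x_i (x) y_j, each lying in its own summand of the n-th tensor power. *)
Definition tmul_comp (x y : tensalg) (n : nat) : tpow_rec n :=
  match n with
  | 0 => unroll (x 0%N) * unroll (y 0%N)
  | 1 => unroll (x 0%N) *: unroll (y 1%N) + unroll (y 0%N) *: unroll (x 1%N)
  | n'.+2 => unroll (x 0%N) *: unroll (y n'.+2) +
             unroll (y 0%N) *: unroll (x n'.+2) +
             dsum_fin (fun i : 'I_n'.+1 => tens (x i.+1) (y (n'.+1 - i)%N))
  end.

Fact tmul_finsupp x y : (fun n => roll (tmul_comp x y n)) \in @finsupp K _ tpow.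
Proof.
have bound (z : tensalg) : exists b, forall n, (b < n)%N -> z n = 0.
  have [s sz] := dsum_finsupp z; exists (\max_(i <- s) i)%N => n ltn.
  apply: sz; apply: contraTN ltn => ns.
  by rewrite -leqNgt; apply: (leq_bigmax_seq (F := id)).
have unroll0 n : @unroll n 0 = 0 by rewrite -[0]roll0 rollK.
have [a xa] := bound x; have [b yb] := bound y.
apply/asboolP; exists (iota 0 (a + b).+2) => n.
rewrite mem_iota add0n -leqNgt => ltn.
have -> : tmul_comp x y n = 0; last exact: roll0.
case: n ltn => [|[|n]] // ltn; rewrite /= (xa n.+2) ?(yb n.+2); try lia.
rewrite !unroll0 !scaler0 !add0r; apply/dsumP=> i.
change (tens (x i.+1) (y (n.+1 - i)%N) = 0).
have [lti|gei] := ltnP a i.+1; first by rewrite xa // tens0l.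
by rewrite (yb (n.+1 - i)%N) ?tens0r //; have := ltn_ord i; lia.
Qed.

Definition tmul (x y : tensalg) : tensalg := DSum (tmul_finsupp x y).

Definition tinj_comp (x : M) (n : nat) : tpow n :=
  match n with
  | 1 => @roll 1 x
  | _ => 0
  end.

Fact tinj_finsupp x : tinj_comp x \in @finsupp K _ tpow.
Proof. by apply/asboolP; exists [:: 1%N] => -[|[|n]]. Qed.

Definition tinj (x : M) : tensalg := DSum (tinj_finsupp x).

(* Two-sided ideal of the nonassociative algebra tensalg generated by X. *)
Definition ideal_gen (X : tensalg -> Prop) : {pred tensalg} := fun u =>
  `[< forall S : submodClosed tensalg,
      (forall v w, w \in S -> tmul v w \in S /\ tmul w v \in S) ->
      (forall v, X v -> v \in S) -> u \in S >].

Fact ideal_gen_submod X : submod_closed (ideal_gen X).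
Proof.
split=> [|a u v /asboolP uX /asboolP vX]; apply/asboolP=> S IS XS.
  by case: (submodClosedP S).
by case: (submodClosedP S) => _; apply; [apply: uX | apply: vX].
Qed.
HB.instance Definition _ X := GRing.isSubmodClosed.Build K tensalg (ideal_gen X)
  (GRing.submod_closed_semi (ideal_gen_submod X)).

End NonassocTensorAlgebra.

Record superspace (K : fieldType) := Superspace {
  super_carrier :> lmodType K;
  super_part : 'Z_2 -> submodClosed super_carrier;
  super_partP : forall x, exists! x01 : super_carrier * super_carrier,
    [/\ x01.1 \in super_part 0, x01.2 \in super_part 1 & x = x01.1 + x01.2]
}.

(* Degrees and sign exponents are computed in 'Z_2; the sign only depends on
   the parity of the exponent. *)
Definition ksign (K : fieldType) (a : 'Z_2) : K := (-1) ^+ (a : nat).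
Arguments ksign {K} a.

Record akivis_superalgebra (K : fieldType) := AkivisSuperalgebra {
  akivis_space :> superspace K;
  bracket : akivis_space -> akivis_space -> akivis_space;
  bracket_bilinear : bilinear_for *:%R *:%R bracket;
  bracket_graded : forall (a b : 'Z_2) x y,
    x \in super_part akivis_space a -> y \in super_part akivis_space b ->
    bracket x y \in super_part akivis_space (a + b);
  bracket_anticomm : forall (a b : 'Z_2) x y,
    x \in super_part akivis_space a -> y \in super_part akivis_space b ->
    bracket x y = - (ksign (a * b) *: bracket y x);
  assoc : akivis_space -> akivis_space -> akivis_space -> akivis_space;
  assoc_trilinear :
    [/\ forall y z, linear (fun x => assoc x y z),
        forall x z, linear (fun y => assoc x y z) &
        forall x y, linear (fun z => assoc x y z)];
  assoc_graded : forall (a b c : 'Z_2) x y z,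
    x \in super_part akivis_space a -> y \in super_part akivis_space b ->
    z \in super_part akivis_space c ->
    assoc x y z \in super_part akivis_space (a + b + c);
  akivis_identity : forall (a b c : 'Z_2) x y z,
    x \in super_part akivis_space a -> y \in super_part akivis_space b ->
    z \in super_part akivis_space c ->
    bracket (bracket x y) z
      + ksign (a * (b + c)) *: bracket (bracket y z) x
      + ksign (c * (a + b)) *: bracket (bracket z x) y
    = assoc x y z
      + ksign (a * (b + c)) *: assoc y z x
      + ksign (c * (a + b)) *: assoc z x y
      - ksign (a * b) *: assoc y x z
      - ksign (a * (b + c) + b * c) *: assoc z y x
      - ksign (b * c) *: assoc x z y
}.

Section EnvelopingAlgebra.
Variables (K : fieldType) (M : akivis_superalgebra K).

Inductive akivis_rel : tensalg M -> Prop :=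
| akivis_rel_bracket (a b : 'Z_2) (x y : M) :
    x \in super_part M a -> y \in super_part M b ->
    akivis_rel (tmul (tinj x) (tinj y) - ksign (a * b) *: tmul (tinj y) (tinj x)
                - tinj (bracket x y))
| akivis_rel_assoc (a b c : 'Z_2) (x y z : M) :
    x \in super_part M a -> y \in super_part M b -> z \in super_part M c ->
    akivis_rel (tmul (tmul (tinj x) (tinj y)) (tinj z)
                - tmul (tinj x) (tmul (tinj y) (tinj z))
                - tinj (assoc x y z)).

Definition akivis_env : lmodType K := lquot (ideal_gen akivis_rel).

Definition akivis_iota (x : M) : akivis_env := lquot_pi _ (tinj x).

End EnvelopingAlgebra.

(* Main.v *)
From HB Require Import structures.
Require Import Defs.
From mathcomp Require Import all_boot all_algebra.
From mathcomp Require Import boolp freeg ring zify.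

Import GRing.Theory.
Local Open Scope ring_scope.

Set Implicit Arguments.
Unset Strict Implicit.
Unset Printing Implicit Defensive.

(* It suffices to embed M in some superalgebra B whose supercommutator and
   associator restrict to [,] and A on M, since tensalg M maps to B.  Such a B
   exists with underlying space M + M (x) M.  Products of elements of M are
   x y = [x,y]/2 + x o y, with x o y the supersymmetrization of x (x) y, and
   M (x) M has zero product with itself.  Products of M (x) M with M on the
   right and on the left are trilinear maps R and L, of which only the
   supersymmetrizations r (in the first two variables) and l (in the last two)
   matter; the associator is right as soon as r - l = C, where
     C(x,y,z) = A(x,y,z) - [x,y]z/2 + x[y,z]/2.
   In the group algebra of S_3 over a field of characteristic not 2 or 3, the
   right ideals generated by 1 + (12) and 1 + (23) add up to the complement of
   the sign idempotent, so that r and l exist if and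
   only if the super-alternating sum of C vanishes, and that is the Akivis
   identity. *)

(* Linear identities between vectors are proved by reflection: lmod reduces one
   to the equality of the coefficients of each atom. *)
Section LinearExpressions.
Variables (K : fieldType) (V : lmodType K).

Inductive lexp :=
  | LVar of nat | LZero | LAdd of lexp & lexp | LOpp of lexp
  | LScale of K & lexp.

Fixpoint leval (env : seq V) (e : lexp) : V :=
  match e with
  | LVar n => nth 0 env n
  | LZero => 0
  | LAdd e1 e2 => leval env e1 + leval env e2
  | LOpp e1 => - leval env e1
  | LScale k e1 => k *: leval env e1
  end.

(** [Nat.eqb] on numerals computes under [simpl], so the coefficients become explicit scalar
    expressions. *)
Fixpoint lcoef (e : lexp) (i : nat) : K :=
  match e with
  | LVar n => if Nat.eqb i n then 1 else 0
  | LZero => 0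
  | LAdd e1 e2 => lcoef e1 i + lcoef e2 i
  | LOpp e1 => - lcoef e1 i
  | LScale k e1 => k * lcoef e1 i
  end.

(** A recursive conjunction rather than a quantifier, so that [simpl; repeat split] yields one
    scalar goal per atom. *)
Fixpoint same_coefs (e1 e2 : lexp) (n : nat) : Prop :=
  if n is n'.+1 then lcoef e1 n' = lcoef e2 n' /\ same_coefs e1 e2 n' else True.

Lemma levalE env e : leval env e = \sum_(i < size env) lcoef e i *: nth 0 env i.
Proof.
elim: e => [n||e1 IH1 e2 IH2|e1 IH|k e1 IH] /=.
- have [nlt|nge] := ltnP n (size env); last first.
    rewrite nth_default // big1 // => i _.
    have -> : Nat.eqb i n = false by apply/PeanoNat.Nat.eqb_neq => ein; have := ltn_ord i; lia.
    exact: scale0r.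
  rewrite (bigD1 (Ordinal nlt)) //= PeanoNat.Nat.eqb_refl scale1r big1 ?addr0 //.
  move=> i /eqP ne.
  have -> : Nat.eqb i n = false.
    by apply/PeanoNat.Nat.eqb_neq => eqin; apply: ne; apply: val_inj.
  exact: scale0r.
- by rewrite big1 // => i _; rewrite scale0r.
- by rewrite IH1 IH2 -big_split; apply: eq_bigr => i _; rewrite scalerDl.
- by rewrite IH -sumrN; apply: eq_bigr => i _; rewrite scaleNr.
- by rewrite IH scaler_sumr; apply: eq_bigr => i _; rewrite scalerA.
Qed.

Lemma leval_eq env e1 e2 :
  same_coefs e1 e2 (size env) -> leval env e1 = leval env e2.
Proof.
move=> eqc; rewrite !levalE; apply: eq_bigr => i _; congr (_ *: _).
elim: (size env) (i : nat) (ltn_ord i) eqc => [|n IHn] //= j jn [eqn eqs].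
by case: (eqVneq j n) => [-> //|ne]; apply: IHn => //; lia.
Qed.
End LinearExpressions.

Ltac lmod_mem v env :=
  lazymatch env with
  | nil => constr:(false)
  | v :: _ => constr:(true)
  | _ :: ?env' => lmod_mem v env'
  end.
Ltac lmod_index v env :=
  lazymatch env with
  | v :: _ => constr:(0%N)
  | _ :: ?env' => let n := lmod_index v env' in constr:(S n)
  end.
Ltac lmod_atoms t env :=
  lazymatch t with
  | GRing.zero => env
  | GRing.add ?u ?v => let env' := lmod_atoms u env in lmod_atoms v env'
  | GRing.opp ?u => lmod_atoms u env
  | GRing.scale _ ?u => lmod_atoms u env
  | _ => lazymatch lmod_mem t env with
         | true => env
         | false => constr:(t :: env)
         end
  end.
Ltac lmod_reify K t env :=
  lazymatch t with
  | GRing.zero => constr:(LZero K)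
  | GRing.add ?u ?v => let e := lmod_reify K u env in
      let f := lmod_reify K v env in constr:(LAdd e f)
  | GRing.opp ?u => let e := lmod_reify K u env in constr:(LOpp e)
  | GRing.scale ?k ?u => let e := lmod_reify K u env in constr:(LScale k e)
  | _ => let n := lmod_index t env in constr:(LVar K n)
  end.
Ltac lmod K V :=
  lazymatch goal with
  | |- ?s = ?t =>
      let env := lmod_atoms s (@nil V) in
      let env := lmod_atoms t env in
      let e := lmod_reify K s env in
      let f := lmod_reify K t env in
      apply: (@leval_eq K V env e f); simpl; repeat split
  end.

(** * Linear maps out of free modules and tensor products *)

Section LinearMaps.
Variables (K : fieldType).
Implicit Types U V W : lmodType K.

Lemma lin0 U V (f : U -> V) : linear f -> f 0 = 0.
Proof. by move=> lf; have := lf (-1) 0 0; rewrite scaler0 addr0 scaleN1r addNr. Qed.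
Lemma linD U V (f : U -> V) : linear f -> {morph f : x y / x + y}.
Proof. by move=> lf x y; have := lf 1 x y; rewrite !scale1r. Qed.
Lemma linZ U V (f : U -> V) : linear f -> forall a x, f (a *: x) = a *: f x.
Proof. by move=> lf a x; have := lf a x 0; rewrite !addr0 (lin0 lf) addr0. Qed.
Lemma linB U V (f : U -> V) : linear f -> {morph f : x y / x - y}.
Proof. by move=> lf x y; rewrite (linD lf) -(scaleN1r y) (linZ lf) scaleN1r. Qed.
Lemma lin_sum U V (f : U -> V) (lf : linear f) I (r : seq I) (P : pred I) F :
  f (\sum_(i <- r | P i) F i) = \sum_(i <- r | P i) f (F i).
Proof. exact: (big_morph f (linD lf) (lin0 lf)). Qed.

Lemma linear_comp U V W (f : V -> W) (g : U -> V) :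
  linear f -> linear g -> linear (f \o g).
Proof. by move=> lf lg a x y; rewrite /= lg lf. Qed.
Lemma linear_add U V (f g : U -> V) :
  linear f -> linear g -> linear (fun x => f x + g x).
Proof. by move=> lf lg a x y; rewrite lf lg scalerDr addrACA. Qed.
Lemma linear_opp U V (f : U -> V) : linear f -> linear (fun x => - f x).
Proof. by move=> lf a x y; rewrite lf opprD scalerN. Qed.
Lemma linear_scale U V (f : U -> V) k : linear f -> linear (fun x => k *: f x).
Proof. by move=> lf a x y; rewrite lf scalerDr !scalerA mulrC. Qed.

Definition bilin U V W (F : U -> V -> W) :=
  (forall y, linear (fun x => F x y)) /\ (forall x, linear (F x)).
Definition trilin U V V' W (F : U -> V -> V' -> W) :=
  (forall z, bilin (fun x y => F x y z)) /\ (forall x y, linear (F x y)).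

Section Kernel.
Variables (U V : lmodType K) (f : U -> V) (lf : linear f).
(** The linearity proof is an argument so that the subspace structure can be inferred from the term
    [lin_ker lf]. *)
Definition lin_ker of linear f : {pred U} := fun u => f u == 0.
Lemma lin_ker_submod : submod_closed (lin_ker lf).
Proof.
split=> [|a u v]; rewrite ?unfold_in /lin_ker ?(lin0 lf) //.
by rewrite lf => /eqP-> /eqP->; rewrite scaler0 addr0.
Qed.
HB.instance Definition _ := GRing.isSubmodClosed.Build K U (lin_ker lf)
  (GRing.submod_closed_semi lin_ker_submod).
Lemma lspan_ker (X : U -> Prop) : (forall x, X x -> f x = 0) ->
  forall u, u \in lspan X -> f u = 0.
Proof.
move=> X0 u /asboolP uX; apply/eqP; apply: (uX (lin_ker lf)) => x /X0 fx0.
exact/eqP.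
Qed.
End Kernel.


Section FreeLift.
Variables (T : choiceType) (W : lmodType K).
Implicit Type f : T -> W.

HB.instance Definition _ f :=
  GRing.isZmodMorphism.Build {freeg T / K} W (fglift f) (lift_is_additive f).

Lemma fgliftE f (D : {freeg T / K}) :
  fglift f D = \sum_(x <- dom D) coeff x D *: f x.
Proof.
rewrite -{1}[D]freeg_sumE raddf_sum; apply: eq_bigr => x _; exact: liftU.
Qed.

Lemma fglift_linear f : linear (fglift f : {freeg T / K} -> W).
Proof.
move=> a D E; rewrite raddfD /=; congr (_ + _).
(* Scaling by [a != 0] preserves the support, whereas [a = 0] empties it. *)
have [->|a0] := eqVneq a 0; first by rewrite !scale0r raddf0.
rewrite !fgliftE scaler_sumr (perm_big (dom D)); last first.
  by apply: uniq_perm; rewrite ?uniq_dom // => x; rewrite domZ.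
by apply: eq_bigr => x _; rewrite coeffZ scalerA.
Qed.

End FreeLift.

Section TensorLift.
Variables (V V' W : lmodType K).
Implicit Type F : V -> V' -> W.

(** Evaluation on a chosen representative makes sense for any [F], so it can occur in a recursive
    definition before bilinearity is established. *)
Definition tlift F (t : tensor V V') : W := fglift (fun p => F p.1 p.2) (repr t).

(** Two representatives differ by an element of the span of [tensor_rel], on which the free lift of
    a bilinear map vanishes. *)
Lemma tlift_pi F : bilin F -> forall D,
  tlift F (lquot_pi _ D) = fglift (fun p => F p.1 p.2) D.
Proof.
move=> [Fl Fr] D; apply/eqP; rewrite -subr_eq0 -raddfB; apply/eqP.
apply: (lspan_ker (fglift_linear _) (X := @tensor_rel K V V')); last first.
  by rewrite -lquot_piP /lquot_pi reprK.
move=> _ [a v v' w|a v w w']; rewrite raddfB raddfD /= (linZ (fglift_linear _)).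
  by rewrite /pure !liftU !scale1r /= Fl subrr.
by rewrite /pure !liftU !scale1r /= Fr subrr.
Qed.

Lemma tlift_tens F : bilin F -> forall v w, tlift F (tens v w) = F v w.
Proof. by move=> bF v w; rewrite tlift_pi // liftU scale1r. Qed.

Lemma tlift_linear F : bilin F -> linear (tlift F).
Proof.
move=> bF a; elim/lquot_ind=> D; elim/lquot_ind=> E.
by rewrite -lquot_piZ -lquot_piD !tlift_pi // fglift_linear.
Qed.

(** The representative of [t] stays fixed while the parameter [u] varies. *)
Lemma tlift_lin U (F : V -> V' -> U -> W) t :
  (forall x y, linear (F x y)) -> linear (fun u => tlift (fun x y => F x y u) t).
Proof.
move=> Fl a u v; rewrite /tlift !fgliftE scaler_sumr -big_split /=.
by apply: eq_bigr => p _; rewrite Fl scalerDr !scalerA mulrC.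
Qed.

End TensorLift.
End LinearMaps.

(** * Extension of a linear map [j] to the nonassociative tensor algebra *)

Section TensalgLift.
Variables (K : fieldType) (M B : lmodType K) (j : M -> B) (mu : B -> B -> B).
Hypotheses (jl : linear j) (bmu : bilin mu).

(* The fuel k replaces course-of-values recursion on the degree n, and any
   k > n gives the same value. *)
Fixpoint tlift_deg (k n : nat) (x : tpow M n) : B :=
  if k isn't k'.+1 then 0 else
  match n return tpow_rec M n -> B with
  | 0 => fun=> 0
  | 1 => j
  | n'.+2 => fun x => \sum_(i < n'.+1)
      tlift (fun u v => mu (tlift_deg k' u) (tlift_deg k' v)) (x i)
  end (unroll x).

Lemma bilin_comp (U V : lmodType K) (f : U -> B) (g : V -> B) :
  linear f -> linear g -> bilin (fun u v => mu (f u) (g v)).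
Proof.
by move=> lf lg; split=> [y a x x'|x a y y']; rewrite ?lf ?lg (bmu.1, bmu.2).
Qed.

Lemma tlift_deg_linear k n : linear (@tlift_deg k n).
Proof.
elim: k n => [|k IHk] n a x y; first by rewrite scaler0 addr0.
rewrite /= unroll_linear; move: (unroll x) (unroll y) => {x y}.
case: n => [|[|n]] x y; first by rewrite scaler0 addr0.
  exact: jl.
rewrite scaler_sumr -big_split; apply: eq_bigr => i _.
exact: (tlift_linear (bilin_comp (IHk _) (IHk _))).
Qed.

Lemma tlift_deg_fuel k k' n (x : tpow M n) : (n < k)%N -> (n < k')%N ->
  tlift_deg k x = tlift_deg k' x.
Proof.
elim: k k' n x => [|k IHk] [|k'] n x //; rewrite !ltnS => nk nk' /=.
move: (unroll x) => {x}; case: n nk nk' => [|[|n]] // nk nk' x.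
apply: eq_bigr => i _; congr tlift.
have ltin := ltn_ord i.
apply: functional_extensionality_dep => u; apply: functional_extensionality_dep => v.
by congr mu; apply: IHk; lia.
Qed.

Lemma tlift_deg_roll k n (x : tpow_rec M n.+2) : tlift_deg k.+1 (roll x) =
  \sum_(i < n.+1) tlift (fun u v => mu (tlift_deg k u) (tlift_deg k v)) (x i).
Proof. by rewrite /= rollK. Qed.

Definition tliftn n (x : tpow M n) : B := tlift_deg n.+1 x.

Lemma tliftn_linear n : linear (@tliftn n).
Proof. exact: tlift_deg_linear. Qed.

Lemma tliftn_roll n (x : tpow_rec M n.+2) : tliftn (roll x) =
  \sum_(i < n.+1) tlift (fun u v => mu (tliftn u) (tliftn v)) (x i).
Proof.
rewrite [LHS]tlift_deg_roll; apply: eq_bigr => i _; congr tlift.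
have ltin := ltn_ord i.
apply: functional_extensionality_dep => u; apply: functional_extensionality_dep => v.
by congr mu; apply: tlift_deg_fuel; lia.
Qed.

Lemma tensalg_bound (z : tensalg M) :
  exists b, forall n, (b <= n)%N -> z n = 0.
Proof.
have [s sz] := dsum_finsupp z; exists (\max_(i <- s) i).+1%N => n ltn.
apply: sz; apply: contraTN ltn => ns.
by rewrite -leqNgt; apply: (leq_bigmax_seq (F := id)).
Qed.

(** The bound is an arbitrary choice; [tensalg_liftE] shows that every bound gives the same sum. *)
Definition tensalg_lift (z : tensalg M) : B :=
  \sum_(n < projT1 (cid (tensalg_bound z))) tliftn (z n).

Lemma tensalg_liftE N (z : tensalg M) : (forall n, (N <= n)%N -> z n = 0) ->
  tensalg_lift z = \sum_(n < N) tliftn (z n).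
Proof.
rewrite /tensalg_lift; case: cid => b /= bz Nz.
have extend m k : (forall n, (m <= n)%N -> z n = 0) -> (m <= k)%N ->
    \sum_(n < m) tliftn (z n) = \sum_(n < k) tliftn (z n).
  move=> mz mk; rewrite -!(big_mkord xpredT (fun n => tliftn (z n))).
  rewrite (big_cat_nat (n := m) (p := k)) //= [X in _ + X]big1_seq ?addr0 //.
  move=> n; rewrite mem_index_iota => /andP[_ /andP[mn _]].
  by rewrite mz // (lin0 (@tliftn_linear n)).
by have [bN|/ltnW Nb] := leqP b N; [apply: extend | symmetry; apply: extend].
Qed.


Lemma tensalg_bound2 (y z : tensalg M) :
  exists b, forall n, (b <= n)%N -> y n = 0 /\ z n = 0.
Proof.
have [a ya] := tensalg_bound y; have [b zb] := tensalg_bound z.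
by exists (a + b)%N => n abn; rewrite ya ?zb //; lia.
Qed.

Lemma tensalg_lift_linear : linear tensalg_lift.
Proof.
move=> a y z; have [b yz0] := tensalg_bound2 y z.
have eqb (u : tensalg M) : (forall n, (b <= n)%N -> u n = 0) ->
  tensalg_lift u = \sum_(n < b) tliftn (u n) by apply: tensalg_liftE.
rewrite !eqb => [|n /yz0[]|n /yz0[]|n /yz0[y0 z0]] //; last first.
  by rewrite dsumDE dsumZE y0 z0 scaler0 addr0.
rewrite scaler_sumr -big_split; apply: eq_bigr => i _.
exact: (@tliftn_linear i a (y i) (z i)).
Qed.

Lemma tensalg_lift_tinj x : tensalg_lift (tinj x) = j x.
Proof.
rewrite (@tensalg_liftE 2); last by case=> [|[|n]].
by rewrite !big_ord_recl big_ord0 /= (lin0 (@tliftn_linear _)) add0r addr0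
  /tliftn /= rollK.
Qed.

(** Nonzero terms have [i < a] and [n - i < b], so they all lie below the cut-off [n < a + b] and
    truncation loses nothing. *)
Lemma cauchy_product (f g : nat -> B) a b :
  (forall n, (a <= n)%N -> f n = 0) -> (forall n, (b <= n)%N -> g n = 0) ->
  \sum_(n < a + b) \sum_(i < n.+1) mu (f i) (g (n - i)%N) =
  mu (\sum_(i < a + b) f i) (\sum_(i < a + b) g i).
Proof.
move=> fa gb; rewrite (lin_sum (bmu.1 _)).
transitivity (\sum_(n < a + b) \sum_(i < a + b | (i <= n)%N)
    mu (f i) (g (n - i)%N)).
  apply: eq_bigr => n _; have ltn := ltn_ord n.
  by rewrite (big_ord_widen (a + b) (fun i => mu (f i) (g (n - i)%N))).
rewrite (exchange_big_dep xpredT) //=; apply: eq_bigr => i _.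
rewrite (lin_sum (bmu.2 _)) -(big_mkord (fun n => i <= n)%N
  (fun n => mu (f i) (g (n - i)%N))).
have [ai|ia] := leqP a i.
  by rewrite fa // !big1 // => *; rewrite (lin0 (bmu.1 _)).
rewrite -(big_mkord xpredT (fun n => mu (f i) (g n))).
rewrite [LHS](big_cat_nat (n := i)) //=; last by apply: ltnW.
rewrite [X in X + _ = _]big1_seq ?add0r; last first.
  by move=> n; rewrite mem_index_iota; lia.
(* As [i < a], the indices from [a + b - i] on exceed [b], where [g] vanishes; the rest matches the
   left side after a shift by [i]. *)
rewrite [RHS](big_cat_nat (n := (a + b - i)%N)) //=; last exact: leq_subr.
rewrite [X in _ = _ + X]big1_seq ?addr0; last first.
  move=> n; rewrite mem_index_iota => lin.
  by rewrite gb ?(lin0 (bmu.2 _)) //; lia.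
rewrite -[X in index_iota X]add0n big_addn big_nat_cond [RHS]big_nat_cond.
by apply: eq_big => n; rewrite ?addnK ?leq_addl ?andbT.
Qed.

Lemma tliftn_rollZ n a (x : tpow M n) (t : tpow_rec M n) :
  tliftn (roll (a *: unroll x + t)) = a *: tliftn x + tliftn (roll t).
Proof. by rewrite roll_linear tliftn_linear unrollK. Qed.

Lemma tliftn_tmul y z n : tliftn (tmul y z n.+2) =
  unroll (y 0%N) *: tliftn (z n.+2) + unroll (z 0%N) *: tliftn (y n.+2)
  + \sum_(i < n.+1) mu (tliftn (y i.+1)) (tliftn (z (n - i).+1)).
Proof.
rewrite -[tmul y z n.+2]/(roll (tmul_comp y z n.+2)) /= -!addrA !tliftn_rollZ.
congr (_ + (_ + _)); rewrite tliftn_roll; apply: eq_bigr => i _.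
have ltin := ltn_ord i; rewrite -subSn //.
exact: (tlift_tens (bilin_comp (@tliftn_linear _) (@tliftn_linear _))).
Qed.

(** Scalars are sent to 0, as [B] has no unit. The formula is the [B]-component of the product in
    the unitalization of [B], where the scalar component is the degree 0 part. *)
Lemma tensalg_lift_mul y z : tensalg_lift (tmul y z) =
  unroll (y 0%N) *: tensalg_lift z + unroll (z 0%N) *: tensalg_lift y
  + mu (tensalg_lift y) (tensalg_lift z).
Proof.
have [a ya] := tensalg_bound y; have [b zb] := tensalg_bound z.
have [c yzc] := tensalg_bound (tmul y z).
(* [expand] separates degree 1 from degrees at least 2, while [shift] starts at degree 1: products
   of two elements of positive degree start in degree 2. *)
have expand (u : tensalg M) : (forall n, (a + c + b <= n)%N -> u n = 0) ->
    tensalg_lift u = tliftn (u 1%N) + \sum_(n < a + c + b) tliftn (u n.+2).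
  move=> u0; rewrite (@tensalg_liftE (a + c + b).+2); last by move=> n ?; apply: u0; lia.
  by rewrite !big_ord_recl [tliftn (u 0%N)]/= /tliftn /= add0r.
have shift (u : tensalg M) : (forall n, (a + c + b <= n)%N -> u n = 0) ->
    tensalg_lift u = \sum_(n < a + c + b) tliftn (u n.+1).
  move=> u0; rewrite (@tensalg_liftE (a + c + b).+1); last by move=> n ?; apply: u0; lia.
  by rewrite big_ord_recl [tliftn (u 0%N)]/= /tliftn /= add0r.
have y0 n : (a + c + b <= n)%N -> y n = 0 by move=> ?; apply: ya; lia.
have z0 n : (a + c + b <= n)%N -> z n = 0 by move=> ?; apply: zb; lia.
rewrite (shift _ y0) (shift _ z0).
(* The cut-off [a + c + b] is read as the sum of the bounds [a + c] for [y] and [b] for [z]. *)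
rewrite -(@cauchy_product (fun n => tliftn (y n.+1)) (fun n => tliftn (z n.+1)))
  => [|n ?|n ?]; last 2 first.
- by rewrite ya ?(lin0 (@tliftn_linear _)) //; lia.
- by rewrite zb ?(lin0 (@tliftn_linear _)) //; lia.
rewrite -(shift _ y0) -(shift _ z0).
rewrite (expand _ y0) (expand _ z0) (expand (tmul y z)); last by move=> n ?; apply: yzc; lia.
rewrite (eq_bigr _ (fun n _ => tliftn_tmul y z (nat_of_ord n))) !big_split /= addrA.
congr (_ + _); rewrite -!scaler_sumr.
have -> : tliftn (tmul y z 1) =
    unroll (y 0%N) *: tliftn (z 1%N) + unroll (z 0%N) *: tliftn (y 1%N).
  rewrite -[tmul y z 1%N]/(roll (tmul_comp y z 1%N)) /= tliftn_rollZ.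
  by rewrite -[X in roll X]addr0 tliftn_rollZ roll0 (lin0 (@tliftn_linear _)) addr0.
by rewrite !scalerDr addrACA.
Qed.

End TensalgLift.

(** * Injectivity from a suitable superalgebra *)

Section Criterion.
Variables (K : fieldType) (M : akivis_superalgebra K) (B : lmodType K).
Variables (j : M -> B) (mu : B -> B -> B).

(** The lift of [j], paired with the degree 0 component, is multiplicative into the unitalization of
    [B]. Its kernel is therefore a two-sided ideal; it contains the relations, and it meets [M] only
    in 0 because [j] is injective. *)
Lemma akivis_iota_inj : linear j -> injective j -> bilin mu ->
  (forall (a b : 'Z_2) x y, x \in super_part M a -> y \in super_part M b ->
     mu (j x) (j y) - ksign (a * b) *: mu (j y) (j x) = j (bracket x y)) ->
  (forall (a b c : 'Z_2) x y z, x \in super_part M a ->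
     y \in super_part M b -> z \in super_part M c ->
     mu (mu (j x) (j y)) (j z) - mu (j x) (mu (j y) (j z)) = j (assoc x y z)) ->
  injective (@akivis_iota K M).
Proof.
move=> jl jI bmu mu_bracket mu_assoc.
pose Phi := tensalg_lift j mu.
have Phil : linear Phi by apply: tensalg_lift_linear.
have PhiB := linB Phil.
have Phi_tinj x : Phi (tinj x) = j x by apply: tensalg_lift_tinj.
have Phi_mul (u v : tensalg M) : Phi (tmul u v) = unroll (u 0%N) *: Phi v
    + unroll (v 0%N) *: Phi u + mu (Phi u) (Phi v) by exact: tensalg_lift_mul.
have PhiM (u v : tensalg M) : u 0%N = 0 -> v 0%N = 0 -> Phi (tmul u v) = mu (Phi u) (Phi v).
  move=> u0 v0; rewrite Phi_mul u0 v0.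
  by rewrite (lin0 (@unroll_linear _ _ _)) !scale0r !add0r.
have tmul0 (u v : tensalg M) : u 0%N = 0 \/ v 0%N = 0 -> tmul u v 0%N = 0.
  move=> uv0; transitivity (@roll _ M 0 0); last exact: roll0.
  rewrite -[tmul u v 0%N]/(roll (tmul_comp u v 0%N)); congr roll.
  by case: uv0 => /= ->; rewrite (lin0 (@unroll_linear _ _ _)) (mulr0, mul0r).
(* The kernel of [Phi] alone contains the scalars and need not be an ideal, so the degree 0
   component is recorded as well. *)
pose Psi (u : tensalg M) := (u 0%N, Phi u) : tpow M 0 * B.
have Psil : linear Psi by move=> a u v; rewrite /Psi Phil.
have PsiP (u : tensalg M) : reflect (u 0%N = 0 /\ Phi u = 0) (u \in lin_ker Psil).
  by rewrite unfold_in /lin_ker /Psi; apply: (iffP eqP) => [[]|[-> ->]].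
move=> x y /eqP; rewrite lquot_piP => /asboolP xy; apply: jI; apply/eqP.
rewrite -subr_eq0 -!Phi_tinj -PhiB; apply/eqP.
suff /PsiP[] : tinj x - tinj y \in lin_ker Psil by [].
apply: xy => [v w /PsiP[w0 Phiw0]|_ [a b x1 y1 x1a y1b|a b c x1 y1 z1 x1a y1b z1c]].
- have vw (u u' : tensalg M) : u 0%N = 0 /\ Phi u = 0 \/ u' 0%N = 0 /\ Phi u' = 0 ->
      tmul u u' \in lin_ker Psil.
    move=> uu'; apply/PsiP; split.
      by apply: tmul0; case: uu' => [[u0 _]|[u0 _]]; [left|right].
    rewrite Phi_mul; case: uu' => [[-> ->]|[-> ->]].
      by rewrite (lin0 (@unroll_linear _ _ _)) (lin0 (bmu.1 _)) scale0r scaler0 !addr0.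
    by rewrite (lin0 (@unroll_linear _ _ _)) (lin0 (bmu.2 _)) scale0r scaler0 !addr0.
  by split; apply: vw; [right|left].
- apply/PsiP; split.
    rewrite -scaleNr !dsumDE dsumZE -scaleN1r dsumZE !tmul0; try by left.
    by rewrite !scaler0 !addr0.
  by rewrite !PhiB (linZ Phil) !PhiM // !Phi_tinj (mu_bracket a b) // subrr.
- apply/PsiP; split.
    rewrite -!scaleN1r !dsumDE !dsumZE !tmul0; try by left.
    by rewrite !scaler0 !addr0.
  have t0 (u v : M) : tmul (tinj u) (tinj v) 0%N = 0 :> tpow M 0 by apply: tmul0; left.
  by rewrite !PhiB !PhiM // !Phi_tinj (mu_assoc a b c) // subrr.
Qed.
End Criterion.

(** * Odd parts and the sign rule *)

Section Parity.
Variables (K : fieldType) (M : superspace K).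

Definition odd_part (x : M) : M := (projT1 (cid (super_partP x))).2.

Lemma odd_partP (x x0 x1 : M) : x0 \in super_part M 0 -> x1 \in super_part M 1 ->
  x = x0 + x1 -> odd_part x = x1.
Proof.
move=> x00 x11 def_x; rewrite /odd_part; case: cid => p /= [_ uniq_p].
by rewrite (uniq_p (x0, x1)).
Qed.

Lemma odd_part_linear : linear odd_part.
Proof.
have dec x : exists2 x0, x0 \in super_part M 0 &
    odd_part x \in super_part M 1 /\ x = x0 + odd_part x.
  by rewrite /odd_part; case: cid => p /= [[p0 p1 ->] _]; exists p.1.
move=> a x y; have [x0 x00 [x1 {1}->]] := dec x; have [y0 y00 [y1 {1}->]] := dec y.
apply: (@odd_partP _ (a *: x0 + y0)); rewrite ?rpredD ?rpredZ //.
by rewrite scalerDr addrACA.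
Qed.

Lemma odd_part0 x : x \in super_part M 0 -> odd_part x = 0.
Proof. by move=> x0; apply: (odd_partP x0); rewrite ?rpred0 ?addr0. Qed.

Lemma odd_part1 x : x \in super_part M 1 -> odd_part x = x.
Proof. by move=> x1; apply: (@odd_partP _ 0); rewrite ?rpred0 ?add0r. Qed.

Lemma Z2P (P : 'Z_2 -> Prop) : P 0 -> P 1 -> forall a, P a.
Proof.
move=> P0 P1 [[|[|//]] i].
  by rewrite (_ : Ordinal i = 0) //; apply: val_inj.
by rewrite (_ : Ordinal i = 1) //; apply: val_inj.
Qed.

(* F (y, x) with the sign rule extended linearly to inhomogeneous arguments: the
   sign only differs from 1 on the odd parts. *)
Definition superswap (W : lmodType K) (F : M -> M -> W) (x y : M) : W :=
  F y x - 2%:R *: F (odd_part y) (odd_part x).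

Lemma superswapE (W : lmodType K) (F : M -> M -> W) a b x y : bilin F ->
  x \in super_part M a -> y \in super_part M b ->
  superswap F x y = ksign (a * b) *: F y x.
Proof.
move=> [Fl Fr]; rewrite /superswap /ksign.
elim/Z2P: a => xa; elim/Z2P: b => yb;
  rewrite ?(odd_part0 xa) ?(odd_part0 yb) ?(lin0 (Fl _)) ?(lin0 (Fr _))
          ?scaler0 ?subr0 ?expr0 ?scale1r //.
by rewrite (odd_part1 xa) (odd_part1 yb) expr1 scaleN1r scaler_nat mulr2n opprD addNKr.
Qed.

Lemma ksignD (a b : 'Z_2) : ksign (a + b) = ksign a * ksign b :> K.
Proof.
by elim/Z2P: a; elim/Z2P: b; rewrite /ksign /= ?expr0 ?expr1 ?mulr1 ?mul1r ?mulrNN ?mulr1.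
Qed.

Lemma ksign_sqr (a : 'Z_2) : ksign a * ksign a = 1 :> K.
Proof. by elim/Z2P: a; rewrite /ksign /= ?expr0 ?expr1 ?mulrNN mulr1. Qed.

End Parity.

(** * Signed action of the transpositions on trilinear maps *)

Section Swaps.
Variables (K : fieldType) (M : superspace K) (W : lmodType K).

Lemma bilin_superswap (F : M -> M -> W) : bilin F -> bilin (superswap F).
Proof.
have oddl := @odd_part_linear K M.
by move=> [Fl Fr]; split=> [y a x x'|x a y y']; rewrite /superswap oddl ?Fl ?Fr; lmod K W; ring.
Qed.

Definition swap12 (F : M -> M -> M -> W) x y z := superswap (fun u v => F u v z) x y.
Definition swap23 (F : M -> M -> M -> W) x y z := superswap (F x) y z.

Lemma trilinP (F : M -> M -> M -> W) : trilin F -> [/\ forall y z, linear (fun x => F x y z),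
  forall x z, linear (fun y => F x y z) & forall x y, linear (F x y)].
Proof. by move=> [Fb Fr]; split=> // y z; have [] := Fb z. Qed.

Lemma trilin_bilin (F : M -> M -> M -> W) x : trilin F -> bilin (F x).
Proof. by move=> [Fb Fr]; split=> // z; have [] := Fb z. Qed.

Lemma trilin_swap12 F : trilin F -> trilin (swap12 F).
Proof.
move=> [Fb Fr]; split=> [z|x y a z z']; first exact: bilin_superswap.
by rewrite /swap12 /superswap !Fr; lmod K W; ring.
Qed.

Lemma trilin_swap23 F : trilin F -> trilin (swap23 F).
Proof.
move=> tF; have Sr x := bilin_superswap (trilin_bilin x tF).
split=> [z|x y]; last exact: (Sr x).2.
split=> [y a x x'|x]; last exact: (Sr x).1.
by rewrite /swap23 /superswap !(proj1 (tF.1 _)); lmod K W; ring.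
Qed.

Lemma trilin_lin2 k l (F G : M -> M -> M -> W) : trilin F -> trilin G ->
  trilin (fun x y z => k *: F x y z + l *: G x y z).
Proof.
move=> /trilinP[F1 F2 F3] /trilinP[G1 G2 G3].
by split=> [z|x y]; [split=> ?|]; apply: linear_add; apply: linear_scale.
Qed.

Lemma swap12E F (a b : 'Z_2) x y z : trilin F ->
  x \in super_part M a -> y \in super_part M b ->
  swap12 F x y z = ksign (a * b) *: F y x z.
Proof. by move=> [Fb _] xa yb; rewrite /swap12 (superswapE (Fb z) xa yb). Qed.

Lemma swap23E F (b c : 'Z_2) x y z : trilin F ->
  y \in super_part M b -> z \in super_part M c ->
  swap23 F x y z = ksign (b * c) *: F x z y.
Proof.
by move=> tF yb zc; rewrite /swap23 (superswapE (trilin_bilin x tF) yb zc).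
Qed.

Variable (C : M -> M -> M -> W).
Hypothesis tC : trilin C.

(* With s = swap12 and t = swap23, the group algebra identity
     (1 + s)(1 - t)/3 + (1 + t)(1 - s/3 + st/3)/2
       = 1 - (1 - s - t - sts + st + ts)/6
   is the source of the coefficients. *)
Definition splitl x y z := 2%:R / 3%:R *: C x y z + (- (2%:R / 3%:R)) *: swap23 C x y z.
Definition splitr x y z :=
  (-1) *: C x y z + 3%:R^-1 *: (1 *: swap12 C x y z + (-1) *: swap12 (swap23 C) x y z).

(** [splitl] and [splitr] serve as R and L; the two halved symmetrizations are the r and l with r -
    l = C. *)
Lemma split_alt (a b c : 'Z_2) x y z : 2%:R != 0 :> K -> 3%:R != 0 :> K ->
  x \in super_part M a -> y \in super_part M b -> z \in super_part M c ->
  C x y z + ksign (a * (b + c)) *: C y z x + ksign (c * (a + b)) *: C z x y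
  - ksign (a * b) *: C y x z - ksign (a * (b + c) + b * c) *: C z y x
  - ksign (b * c) *: C x z y = 0 ->
  2%:R^-1 *: (splitl x y z + ksign (a * b) *: splitl y x z)
  - 2%:R^-1 *: (splitr x y z + ksign (b * c) *: splitr x z y) = C x y z.
Proof.
move=> n2 n3 xa yb zc.
rewrite /splitl /splitr.
have tC' := trilin_swap23 tC.
rewrite (swap23E x tC yb zc) (swap23E y tC xa zc) (swap12E z tC xa yb).
rewrite (swap12E z tC' xa yb) (swap12E y tC xa zc) (swap12E y tC' xa zc).
rewrite (swap23E y tC xa zc) (swap23E z tC xa yb).
rewrite !mulrDr !ksignD (mulrC c a) (mulrC c b).
move: (ksign (a * b)) (ksign (a * c)) (ksign (b * c)) => e1 e2 e3 alt0.
(* The two sides differ by -1/6 times the super-alternating sum of [C]. *)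
apply/eqP; rewrite -subr_eq0 -(scaler0 _ (- (2%:R * 3%:R)^-1)) -alt0; apply/eqP.
have n6 : 6%:R != 0 :> K by rewrite (natrM _ 2 3) mulf_neq0.
by lmod K W; field; rewrite n6 n3 n2.
Qed.
End Swaps.

(** * The superalgebra structure on M + M (x) M *)

Section AkivisExtension.
Variables (K : fieldType) (M : akivis_superalgebra K).
Hypotheses (n2 : 2%:R != 0 :> K) (n3 : 3%:R != 0 :> K).

Let B : lmodType K := (M * tensor M M)%type.
Let inj (x : M) : B := (x, 0).

Definition ext_mul2 (x y : M) : B :=
  (2%:R^-1 *: bracket x y, 2%:R^-1 *: (tens x y + superswap (@tens K M M) x y)).

(** This is C. Expanding x y = [x,y]/2 + x o y, the associator of x, y, z equals A(x,y,z) exactly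
    when (x o y) z - x (y o z) = C(x,y,z). *)
Definition ext_defect (x y z : M) : B :=
  inj (assoc x y z) - 2%:R^-1 *: ext_mul2 (bracket x y) z
  + 2%:R^-1 *: ext_mul2 x (bracket y z).

Definition ext_mul (p q : B) : B :=
  ext_mul2 p.1 q.1 + (tlift (fun x y => splitl ext_defect x y q.1) p.2
                      + tlift (splitr ext_defect p.1) q.2).

Lemma bilin_bracket : bilin (@bracket K M).
Proof.
by have [Fl Fr] := bracket_bilinear M; split=> y; [apply: Fl|apply: Fr].
Qed.

Lemma bilin_tens : bilin (@tens K M M).
Proof.
by have [Fl Fr] := tens_bilinear M M; split=> y; [apply: Fl|apply: Fr].
Qed.

Lemma inj_linear : linear inj.
Proof. by move=> a x y; rewrite /inj -[0 in LHS](addr0 0) -[X in (_, X + _)](scaler0 _ a). Qed.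

Lemma linear_pair (U V W : lmodType K) (f : U -> V) (g : U -> W) :
  linear f -> linear g -> linear (fun x => (f x, g x) : V * W).
Proof. by move=> lf lg a x y; rewrite lf lg. Qed.

Lemma bilin_ext_mul2 : bilin ext_mul2.
Proof.
have [bl br] := bilin_bracket; have [tl tr] := bilin_tens.
have [sl sr] := bilin_superswap bilin_tens.
by split=> x; apply: linear_pair; apply: linear_scale => //; apply: linear_add.
Qed.

Lemma trilin_ext_defect : trilin ext_defect.
Proof.
have [bl br] := bilin_bracket; have [ml mr] := bilin_ext_mul2.
have [al am ar] := assoc_trilinear M.
split=> [z|x y]; [split=> [y|x]|].
- exact: (linear_add (linear_add (linear_comp inj_linear (al y z))
    (linear_opp (linear_scale _ (linear_comp (ml z) (bl y)))))
    (linear_scale _ (ml (bracket y z)))).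
- exact: (linear_add (linear_add (linear_comp inj_linear (am x z))
    (linear_opp (linear_scale _ (linear_comp (ml z) (br x)))))
    (linear_scale _ (linear_comp (mr x) (bl z)))).
- exact: (linear_add (linear_add (linear_comp inj_linear (ar x y))
    (linear_opp (linear_scale _ (mr (bracket x y)))))
    (linear_scale _ (linear_comp (mr x) (br y)))).
Qed.

Lemma trilin_splitl : trilin (splitl ext_defect).
Proof.
by apply: trilin_lin2; [|apply: trilin_swap23]; apply: trilin_ext_defect.
Qed.

Lemma trilin_splitr : trilin (splitr ext_defect).
Proof.
have tC := trilin_ext_defect; apply: trilin_lin2 => //.
apply: trilin_lin2; first exact: trilin_swap12.
exact/trilin_swap12/trilin_swap23.
Qed.

Lemma bilin_ext_mul : bilin ext_mul.
Proof.
have tl := trilin_splitl; have tr := trilin_splitr.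
have [ml mr] := bilin_ext_mul2.
have fstl : linear (fun p : B => p.1) by [].
have sndl : linear (fun p : B => p.2) by [].
have [tr1 _ _] := trilinP tr.
split=> [q|p].
  (* [tlift_linear] handles the tensor component, [tlift_lin] the component in [M] that enters as a
     parameter; the permuted [F] puts this parameter last. *)
  exact: (linear_add (linear_comp (ml q.1) fstl) (linear_add
    (linear_comp (tlift_linear (tl.1 q.1)) sndl)
    (linear_comp (tlift_lin (F := fun y z x => splitr ext_defect x y z) q.2 tr1) fstl))).
exact: (linear_add (linear_comp (mr p.1) fstl) (linear_add
  (linear_comp (tlift_lin p.2 tl.2) fstl)
  (linear_comp (tlift_linear (trilin_bilin p.1 tr)) sndl))).
Qed.

Lemma ext_mul_inj x y : ext_mul (inj x) (inj y) = ext_mul2 x y.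
Proof.
have tl := trilin_splitl; have tr := trilin_splitr.
rewrite /ext_mul /= (lin0 (tlift_linear (tl.1 _))).
by rewrite (lin0 (tlift_linear (trilin_bilin _ tr))) !addr0.
Qed.

(** The symmetrized parts cancel in the supercommutator, and by superanticommutativity the two
    halves of the bracket add up. *)
Lemma ext_mul2_comm (a b : 'Z_2) x y :
  x \in super_part M a -> y \in super_part M b ->
  ext_mul2 x y - ksign (a * b) *: ext_mul2 y x = inj (bracket x y).
Proof.
move=> xa yb; rewrite /ext_mul2 (superswapE bilin_tens xa yb) (superswapE bilin_tens yb xa).
rewrite (bracket_anticomm yb xa) (mulrC b a).
have := ksign_sqr K (a * b); move: (ksign (a * b)) => e ee.
congr (_, _); rewrite /=; [lmod K M|lmod K (tensor M M)]; by field: ee.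
Qed.

(** In the alternating sum the terms [x,y]z and z[x,y] combine into the supercommutator of [x,y] and
    z, which is [[x,y],z]; the same holds cyclically, leaving the Akivis identity. *)
Lemma ext_defect_alt (a b c : 'Z_2) x y z :
  x \in super_part M a -> y \in super_part M b -> z \in super_part M c ->
  ext_defect x y z + ksign (a * (b + c)) *: ext_defect y z x
  + ksign (c * (a + b)) *: ext_defect z x y
  - ksign (a * b) *: ext_defect y x z
  - ksign (a * (b + c) + b * c) *: ext_defect z y x
  - ksign (b * c) *: ext_defect x z y = 0.
Proof.
move=> xa yb zc; have [ml mr] := bilin_ext_mul2.
have xy := bracket_graded xa yb; have yz := bracket_graded yb zc.
have zx := bracket_graded zc xa.
have := congr1 inj (akivis_identity xa yb zc).
rewrite -!scaleN1r !(linD inj_linear) !(linZ inj_linear).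
(* The double brackets are turned back into supercommutators of [ext_mul2]. *)
rewrite -(ext_mul2_comm xy zc) -(ext_mul2_comm yz xa) -(ext_mul2_comm zx yb).
rewrite /ext_defect (bracket_anticomm yb xa) (bracket_anticomm zc yb).
rewrite (bracket_anticomm xa zc) -!scaleN1r !(linZ (ml _)) !(linZ (mr _)).
rewrite !mulrDr !mulrDl !ksignD (mulrC b a) (mulrC c a) (mulrC c b).
have := ksign_sqr K (a * b); have := ksign_sqr K (a * c).
have := ksign_sqr K (b * c).
move: (ksign (a * b)) (ksign (a * c)) (ksign (b * c)) => e1 e2 e3 ee3 ee2 ee1.
move=> /eqP; rewrite -subr_eq0 => /eqP id0.
rewrite -[RHS]oppr0 -id0.
by lmod K B; field: ee1 ee2 ee3.
Qed.

Lemma ext_mul_assoc (a b c : 'Z_2) x y z :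
  x \in super_part M a -> y \in super_part M b -> z \in super_part M c ->
  ext_mul (ext_mul (inj x) (inj y)) (inj z) -
  ext_mul (inj x) (ext_mul (inj y) (inj z)) = inj (assoc x y z).
Proof.
move=> xa yb zc; have [ml mr] := bilin_ext_mul2.
have tl := trilin_splitl; have tr := trilin_splitr.
rewrite !ext_mul_inj /ext_mul /=.
rewrite (lin0 (tlift_linear (tl.1 _))) (lin0 (tlift_linear (trilin_bilin _ tr))).
rewrite (superswapE bilin_tens xa yb) (superswapE bilin_tens yb zc).
have lsl := tlift_linear (tl.1 z); have lsr := tlift_linear (trilin_bilin x tr).
rewrite !(linZ lsl) !(linZ lsr) !(linD lsl) !(linD lsr) !(linZ lsl) !(linZ lsr).
rewrite !(tlift_tens (tl.1 z)) !(tlift_tens (trilin_bilin x tr)).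
rewrite (linZ (ml _)) (linZ (mr _)) addr0 add0r.
have alt0 := ext_defect_alt xa yb zc.
have def := split_alt trilin_ext_defect n2 n3 xa yb zc alt0.
apply/eqP; rewrite -subr_eq0; apply/eqP.
(* Only the isolated C(x,y,z) is unfolded; the first four occurrences sit inside [splitl] and
   [splitr], which remain atoms for [lmod]. *)
move: def; rewrite {5}/ext_defect => /eqP; rewrite -subr_eq0 => /eqP def0.
by rewrite -[RHS]def0; lmod K B; ring.
Qed.
End AkivisExtension.

Theorem corollary1 (K : fieldType) (char2 : 2%N \notin [pchar K])
    (char3 : 3%N \notin [pchar K]) (M : akivis_superalgebra K) :
  injective (@akivis_iota K M).
Proof.
have n2 : 2%:R != 0 :> K by move: char2; rewrite inE.
have n3 : 3%:R != 0 :> K by move: char3; rewrite inE.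
apply: (@akivis_iota_inj K M _ (fun x => (x, 0)) (@ext_mul K M)).
- exact: inj_linear.
- by move=> x y [].
- exact: bilin_ext_mul.
- by move=> a b x y xa yb; rewrite !ext_mul_inj //; apply: ext_mul2_comm.
- by move=> a b c x y z xa yb zc; apply: (@ext_mul_assoc _ _ _ _ a b c).
Qed.
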